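(* Let $(X,\mu,T)$ be a nonsingular dynamical system. Suppose that either (a) $T$ is aperiodic, forward measurable, and admits a $\mu$-compatible metric for which $T$ is an isometry; or (b) $T$ is conservative ergodic. Then there exists a $\mu$-compatible metric $d$ on $X$ such that $T$ is W-measurably sensitive with respect to $d$.
   Context: A nonsingular dynamical system $(X,\mu,T)$ consists of a standard Borel space $X$ with a $\sigma$-finite nonatomic (nonzero) measure $\mu$ and a measurable map $T:X\to X$ such that $\mu(A)=0$ iff $\mu(T^{-1}A)=0$ for measurable $A$. $T$ is conservative if for every $A$ with $\mu(A)>0$ there is $n>0$ with $\mu(T^{-n}A\cap A)>0$, and ergodic if $T^{-1}(A)=A$ implies $\mu(A)=0$ or $\mu(X\setminus A)=0$. $T$ is aperiodic if its set of periodic points $\{x: T^nx=x\text{ for some }n\ge1\}$ has measure zero. $T$ is forward measurable if $T(A)$ is measurable for every measurable $A$. $T$ is an isometry for a metric $d'$ if $d'(Tx,Ty)=d'(x,y)$ for all $x,y\in X$. All metrics on $X$ are assumed Borel measurable on $X\times X$ and bounded by $1$. A metric $d$ is $\mu$-compatible if every nonempty open $d$-ball has positive $\mu$-measure. $T$ is W-measurably sensitive with respect to $d$ if there is $\delta>0$ such that for each $x\in X$, $\limsup_{n\to\infty}d(T^nx,T^ny)>\delta$ for a.e. $y\in X$. *)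

(* Defs.v *)
From mathcomp Require Import all_boot all_order all_algebra.
From mathcomp Require Import all_classical all_reals all_analysis.

Set Implicit Arguments.
Unset Strict Implicit.
Unset Printing Implicit Defensive.

Import Order.TTheory GRing.Theory Num.Theory.
Import numFieldNormedType.Exports.

Local Open Scope classical_set_scope.
Local Open Scope ring_scope.
Local Open Scope ereal_scope.

Definition complete_separable (R : realType) (Y : metricType R) : Prop :=
  (forall F : set_system Y, ProperFilter F -> cauchy F -> exists y : Y, F --> y) /\
  (exists2 D : set Y, countable D & dense D).

(* X is isomorphic, as a measurable space, to a Polish space endowed with its
   Borel sigma-algebra. *)
Definition standard_Borel (R : realType) (disp : measure_display)
    (X : measurableType disp) : Prop :=
  exists (Y : metricType R) (f : X -> Y),
    [/\ complete_separable Y, set_bij [set: X] [set: Y] f &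
        forall A : set X, measurable A <-> <<s @open Y >> (f @` A)].

Definition nonatomic (R : realType) (disp : measure_display)
    (X : measurableType disp) (mu : set X -> \bar R) : Prop :=
  forall A, measurable A -> 0 < mu A ->
    exists B, [/\ measurable B, B `<=` A, 0 < mu B & mu B < mu A].

Record nonsingular_system (R : realType) (disp : measure_display)
    (X : measurableType disp) (mu : {measure set X -> \bar R})
    (T : X -> X) : Prop := {
  system_standard_Borel : standard_Borel R X ;
  system_sigma_finite : sigma_finite [set: X] mu ;
  system_nonatomic : nonatomic mu ;
  system_nonzero : mu [set: X] != 0 ;
  system_measurable : measurable_fun [set: X] T ;
  system_nonsingular :
    forall A, measurable A -> (mu A = 0 <-> mu (T @^-1` A) = 0) }.

Definition conservative (R : realType) (disp : measure_display)
    (X : measurableType disp) (mu : set X -> \bar R) (T : X -> X) : Prop :=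
  forall A, measurable A -> 0 < mu A ->
    exists2 n : nat, (0 < n)%N & 0 < mu (iter n T @^-1` A `&` A).

Definition ergodic (R : realType) (disp : measure_display)
    (X : measurableType disp) (mu : set X -> \bar R) (T : X -> X) : Prop :=
  forall A, measurable A -> T @^-1` A = A -> mu A = 0 \/ mu (~` A) = 0.

Definition aperiodic (R : realType) (disp : measure_display)
    (X : measurableType disp) (mu : set X -> \bar R) (T : X -> X) : Prop :=
  mu.-negligible [set x | exists2 n : nat, (0 < n)%N & iter n T x = x].

Definition forward_measurable (disp : measure_display)
    (X : measurableType disp) (T : X -> X) : Prop :=
  forall A : set X, measurable A -> measurable (T @` A).

Definition isometry_for (R : realType) (X : Type) (d : X -> X -> R)
    (T : X -> X) : Prop :=
  forall x y, d (T x) (T y) = d x y.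

(* Metrics are plain functions, so that X can carry several of them; Borel
   measurability is with respect to the product sigma-algebra, which for a
   standard Borel X is the Borel sigma-algebra of X * X. *)
Record bounded_Borel_metric (R : realType) (disp : measure_display)
    (X : measurableType disp) (d : X -> X -> R) : Prop := {
  metric_ge0 : forall x y, (0 <= d x y)%R ;
  metric_eq0 : forall x y, d x y = 0%R <-> x = y ;
  metric_symmetric : forall x y, d x y = d y x ;
  metric_triangular : forall x y z, (d x z <= d x y + d y z)%R ;
  metric_le1 : forall x y, (d x y <= 1)%R ;
  metric_measurable :
    measurable_fun [set: (X * X)%type] (fun p : X * X => d p.1 p.2) }.

Definition compatible_metric (R : realType) (disp : measure_display)
    (X : measurableType disp) (mu : set X -> \bar R)
    (d : X -> X -> R) : Prop :=
  bounded_Borel_metric d /\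
  forall (x : X) (r : R), [set y | (d x y < r)%R] !=set0 ->
    0 < mu [set y | (d x y < r)%R].

Definition W_measurably_sensitive (R : realType) (disp : measure_display)
    (X : measurableType disp) (mu : {measure set X -> \bar R}) (T : X -> X)
    (d : X -> X -> R) : Prop :=
  exists2 delta : R, (0 < delta)%R &
    forall x : X, {ae mu, forall y : X,
      delta%:E < limn_esup (fun n => (d (iter n T x) (iter n T y))%:E)}.

(* Main.v *)
(* If every class {y | p(T^n y) = p(T^n x) for all n} of some countable
   measurable partition p is null, then for each x the itineraries of x and of
   almost every y differ infinitely often, so T is W-measurably sensitive for
   any metric putting points of different cells at distance 1.  A compatible
   such metric, up to changing p on a null set, is 2^-(first difference) for an
   injective coding of X by sequences all of whose cylinders have positive
   measure and whose first digit is the cell.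
   (b) Any partition into infinitely many cells of positive measure works: a
   non-null class returns to itself, so its itinerary is periodic and misses a
   cell, while almost every orbit visits all cells.
   (a) Code X by 0-1 sequences.  The lexicographically least cluster point of
   the codes along an orbit is T-invariant; an orbit approaches it arbitrarily
   well and, being aperiodic, hits it at most once.  Let p record the length k
   of agreement with this cluster point together with a cell of d'-diameter
   at most 2^(1-k).  Points with equal itineraries are then, at some time, at
   arbitrarily small d'-distance, hence equal since T is an isometry. *)

Require Import Defs.
From mathcomp Require Import all_boot all_order all_algebra.
From mathcomp Require Import all_classical all_reals all_analysis.
From mathcomp Require Import lra zify.

Set Implicit Arguments.
Unset Strict Implicit.
Unset Printing Implicit Defensive.

Import Order.TTheory GRing.Theory Num.Theory.
Import numFieldNormedType.Exports.

Local Open Scope classical_set_scope.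
Local Open Scope ring_scope.
Local Open Scope ereal_scope.

(** * Least indices and measurability of countable case distinctions *)

Definition first_index (P : nat -> Prop) : option nat :=
  if pselect (exists n, `[< P n >]) is left h then Some (ex_minn h) else None.

Variant first_index_spec (P : nat -> Prop) : option nat -> Prop :=
| FirstIndexNone of (forall n, ~ P n) : first_index_spec P None
| FirstIndexSome n of P n & (forall i, (i < n)%N -> ~ P i) :
    first_index_spec P (Some n).

Lemma first_indexP P : first_index_spec P (first_index P).
Proof.
rewrite /first_index; case: pselect => [h|h].
  case: ex_minnP => m /asboolP Pm mmin; apply: FirstIndexSome => // i im.
  by move=> /asboolP /mmin; rewrite leqNgt im.
by apply: FirstIndexNone => n Pn; apply: h; exists n; apply/asboolP.
Qed.

Lemma first_index_eq_some P n :
  first_index P = Some n <-> P n /\ forall i, (i < n)%N -> ~ P i.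
Proof.
case: first_indexP => [nP|m Pm mmin]; first by split=> // -[/nP].
split=> [[<-//]|[Pn nmin]]; congr Some.
by case: (ltngtP m n) => [/nmin|/mmin|].
Qed.

Section measurable_comprehension.
Context {disp : measure_display} {X : measurableType disp}.
Implicit Types P Q : X -> Prop.

Lemma measurable_const (p : Prop) : measurable [set _ : X | p].
Proof.
have [h|h] := pselect p.
  rewrite (_ : [set _ | _] = setT); first exact: measurableT.
  by apply/seteqP; split.
rewrite (_ : [set _ | _] = set0); first exact: measurable0.
by apply/seteqP; split.
Qed.

Lemma measurable_not P : measurable [set x | P x] -> measurable [set x | ~ P x].
Proof. by move=> mP; exact: (measurableC mP). Qed.

Lemma measurable_and_prop P Q :
  measurable [set x | P x] -> measurable [set x | Q x] ->
  measurable [set x | P x /\ Q x].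
Proof. by move=> mP mQ; exact: (measurableI _ _ mP mQ). Qed.

Lemma measurable_or_prop P Q :
  measurable [set x | P x] -> measurable [set x | Q x] ->
  measurable [set x | P x \/ Q x].
Proof. by move=> mP mQ; exact: (measurableU _ _ mP mQ). Qed.

Lemma measurable_impl (p : Prop) P :
  measurable [set x | P x] -> measurable [set x | p -> P x].
Proof.
move=> mP; have [h|h] := pselect p.
  rewrite (_ : [set _ | _] = [set x | P x])//.
  by apply/seteqP; split=> x /=; auto.
rewrite (_ : [set _ | _] = setT); first exact: measurableT.
by apply/seteqP; split=> x //= _ /h.
Qed.

Lemma measurable_exists (I : countType) (P : I -> X -> Prop) :
  (forall i, measurable [set x | P i x]) ->
  measurable [set x | exists i, P i x].
Proof.
move=> mP.
rewrite (_ : [set x | _] =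
    \bigcup_n (if unpickle n is Some i then [set x | P i x] else set0)).
  by apply: bigcupT_measurable => n; case: unpickle => [i|//]; exact: mP.
apply/seteqP; split=> [x /= [i Pix]|x /= [n _]].
  by exists (pickle i) => //; rewrite pickleK.
by case: unpickle => [i Pix|//]; exists i.
Qed.

Lemma measurable_forall (I : countType) (P : I -> X -> Prop) :
  (forall i, measurable [set x | P i x]) ->
  measurable [set x | forall i, P i x].
Proof.
move=> mP; rewrite (_ : [set x | _] = [set x | ~ exists i, ~ P i x]).
  by apply/measurable_not/measurable_exists => i; exact/measurable_not.
apply/seteqP; split=> [x /= Px [i]|x /= nP i]; first exact.
by apply: contrapT => nPi; apply: nP; exists i.
Qed.

(** Any subset of a countable type is a countable union of points, so [B] can be arbitrary and only
    the fibres of [f] have to be checked. *)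
Lemma measurable_discrete (I : countType) (f : X -> I) (B : I -> Prop) :
  (forall i, measurable [set x | f x = i]) -> measurable [set x | B (f x)].
Proof.
move=> mf; rewrite (_ : [set x | _] = [set x | exists i, f x = i /\ B i]).
  by apply: measurable_exists => i; apply: measurable_and_prop => //;
    exact: measurable_const.
by apply/seteqP; split=> [x /= Bx|x /= [i [-> //]]]; exists (f x).
Qed.

Lemma measurable_discrete2 (I J : countType) (f : X -> I) (g : X -> J)
    (B : I -> J -> Prop) :
  (forall i, measurable [set x | f x = i]) ->
  (forall j, measurable [set x | g x = j]) ->
  measurable [set x | B (f x) (g x)].
Proof.
move=> mf mg.
rewrite (_ : [set x | _] = [set x | exists i, f x = i /\ B i (g x)]).
  by apply: measurable_exists => i; apply: measurable_and_prop => //;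
    exact: measurable_discrete.
by apply/seteqP; split=> [x /= Bx|x /= [i [-> //]]]; exists (f x).
Qed.

Lemma measurable_asbool P (b : bool) :
  measurable [set x | P x] -> measurable [set x | `[< P x >] = b].
Proof.
move=> mP; case: b.
  suff -> : [set x | `[< P x >] = true] = [set x | P x] by [].
  by apply/seteqP; split=> x /= /asboolP.
suff -> : [set x | `[< P x >] = false] = [set x | ~ P x].
  exact: measurable_not.
by apply/seteqP; split=> x /= => [/negbT/asboolPn|/asboolPn/negbTE].
Qed.

Lemma measurable_first_index (P : nat -> X -> Prop) (o : option nat) :
  (forall n, measurable [set x | P n x]) ->
  measurable [set x | first_index (P^~ x) = o].
Proof.
move=> mP; case: o => [n|].
  rewrite (_ : [set x | _] =
      [set x | P n x /\ forall i, (i < n)%N -> ~ P i x]).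
    apply: measurable_and_prop => //; apply: measurable_forall => i.
    by apply: measurable_impl; exact: measurable_not.
  by apply/seteqP; split=> x /=; rewrite first_index_eq_some.
rewrite (_ : [set x | _] = [set x | forall n, ~ P n x]).
  by apply: measurable_forall => n; exact: measurable_not.
by apply/seteqP; split=> x /=; case: first_indexP => // n Pn _ /(_ n).
Qed.

End measurable_comprehension.

Lemma measurable_preimage_iter (disp : measure_display)
    (X : measurableType disp) (T : X -> X) (n : nat) (U : set X) :
  measurable_fun [set: X] T -> measurable U ->
  measurable [set x | U (iter n T x)].
Proof.
move=> mT mU; elim: n => [//|n IH].
rewrite (_ : [set x | _] = T @^-1` [set x | U (iter n T x)]).
  by rewrite -[X in measurable X]setTI; exact: mT.
by apply/seteqP; split=> x /=; rewrite -iterS iterSr.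
Qed.

(** * Null sets under a nonsingular map *)

Section nonsingular.
Context {R : realType} {disp : measure_display} {X : measurableType disp}.
Variables (mu : {measure set X -> \bar R}) (T : X -> X).

Lemma gt0_negligible (A : set X) : measurable A ->
  0 < mu A <-> ~ mu.-negligible A.
Proof.
move=> mA; rewrite lt_neqAle measure_ge0 andbT eq_sym; split.
  by move=> /eqP A0 /(negligibleP _ mA).
by move=> h; apply/eqP => A0; apply: h; apply/negligibleP.
Qed.

Lemma negligible_exists (I : countType) (P : I -> X -> Prop) :
  (forall i, mu.-negligible [set x | P i x]) ->
  mu.-negligible [set x | exists i, P i x].
Proof.
move=> nP; apply: (@negligibleS _ _ _ _ (\bigcup_n
    (if unpickle n is Some i then [set x | P i x] else set0))).
  by move=> x /= [i Pix]; exists (pickle i) => //; rewrite pickleK.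
by apply: negligible_bigcup => n; case: unpickle => [i|];
  [exact: nP|exact: negligible_set0].
Qed.

Lemma negligible_preimage_iter (n : nat) (N : set X) :
  nonsingular_system mu T ->
  mu.-negligible N -> mu.-negligible [set x | N (iter n T x)].
Proof.
move=> sys; elim: n N => [//|n IH] N [A [mA A0 NA]].
have TA : mu (T @^-1` A) = 0 by apply/(system_nonsingular sys mA).
apply: (@negligibleS _ _ _ _ [set x | (T @^-1` A) (iter n T x)]).
  by move=> x /= /NA.
apply: IH; apply/negligibleP => //.
by rewrite -[X in measurable X]setTI; apply: system_measurable sys _ _ _.
Qed.

End nonsingular.

Lemma half_expr_lt (R : realType) (r : R) :
  (0 < r)%R -> exists k, ((1 / 2) ^+ k < r)%R.
Proof.
move=> r0; have half1 : (`|1 / 2 : R| < 1)%R by rewrite ger0_norm; lra.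
have /cvgrPdist_lt hlt := cvg_expr half1; have [k _ hk] := hlt _ r0.
exists k; move: (hk k (leqnn k)) => /=.
by rewrite sub0r normrN ger0_norm ?exprn_ge0.
Qed.

Lemma measurable_metric_ball (R : realType) (disp : measure_display)
    (X : measurableType disp) (d : X -> X -> R) (x : X) (r : R) :
  measurable_fun [set: X * X] (fun p => d p.1 p.2) ->
  measurable [set y | (d x y < r)%R].
Proof.
move=> md; have := measurableT_comp md (pair1_measurable x).
move=> /(_ measurableT _ (measurable_itv `]-oo, r[)).
by rewrite setTI; congr measurable; apply/seteqP; split=> y /=; rewrite in_itv.
Qed.

(** * The metric 2^-(first difference) of a coding *)

Section code_metric.
Context {R : realType} {X : Type}.
Variable g : X -> nat -> nat.

Definition code_agree (k : nat) (x y : X) :=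
  forall i, (i < k)%N -> g x i = g y i.

Definition code_dist (x y : X) : R :=
  if first_index (fun i => g x i <> g y i) is Some m then ((1 / 2) ^+ m)%R
  else 0%R.

Variant code_dist_spec (x y : X) : R -> Prop :=
| CodeDistEq of g x = g y : code_dist_spec x y 0%R
| CodeDistNeq m of g x m <> g y m & code_agree m x y :
    code_dist_spec x y ((1 / 2) ^+ m)%R.

Lemma code_distP x y : code_dist_spec x y (code_dist x y).
Proof.
rewrite /code_dist; case: first_indexP => [h|m gm h].
  by apply: CodeDistEq; apply/funext => i; apply: contrapT => /h.
by apply: CodeDistNeq => // i /h /contrapT.
Qed.

Lemma code_dist_le k x y :
  code_agree k x y -> (code_dist x y <= (1 / 2) ^+ k)%R.
Proof.
move=> xy; case: code_distP => [_|m gm _]; first by rewrite exprn_ge0.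
have km : (k <= m)%N by rewrite leqNgt; apply/negP => /xy.
by rewrite ler_wiXn2l//; lra.
Qed.

Lemma code_dist_ge k x y : g x k <> g y k -> ((1 / 2) ^+ k <= code_dist x y)%R.
Proof.
move=> gk; case: code_distP => [gxy|m _ gm]; first by rewrite gxy in gk.
have mk : (m <= k)%N by rewrite leqNgt; apply/negP => /gm.
by rewrite ler_wiXn2l//; lra.
Qed.

Lemma code_dist_ge0 x y : (0 <= code_dist x y)%R.
Proof. by case: code_distP => // m _ _; rewrite exprn_ge0. Qed.

Lemma code_dist_sym x y : code_dist x y = code_dist y x.
Proof.
apply/eqP; rewrite eq_le; apply/andP; split.
  by case: (code_distP x y) => [_|m gm _]; [exact: code_dist_ge0|
    apply: code_dist_ge => /esym].
by case: (code_distP y x) => [_|m gm _]; [exact: code_dist_ge0|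
  apply: code_dist_ge => /esym].
Qed.

(** At the first index where [x] and [z] differ, [y] differs from one of them, so one summand alone
    already dominates. *)
Lemma code_dist_triangle x y z :
  (code_dist x z <= code_dist x y + code_dist y z)%R.
Proof.
case: (code_distP x z) => [_|m gm _]; first by rewrite addr_ge0// code_dist_ge0.
have [xy|xy] := eqVneq (g x m) (g y m).
  apply: ler_wpDl; first exact: code_dist_ge0.
  by apply: code_dist_ge; rewrite -xy.
by apply: ler_wpDr; [exact: code_dist_ge0|apply: code_dist_ge; apply/eqP].
Qed.

End code_metric.

(** A ball of radius above [(1 / 2) ^+ k] contains the cylinder of length [k] around its centre,
    which is not null. *)
Lemma compatible_code_dist (R : realType) (disp : measure_display)
    (X : measurableType disp) (mu : {measure set X -> \bar R})
    (g : X -> nat -> nat) :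
  injective g -> (forall k i, measurable [set x | g x k = i]) ->
  (forall x k, ~ mu.-negligible [set y | code_agree g k x y]) ->
  compatible_metric mu (code_dist g : X -> X -> R).
Proof.
move=> ginj mg gpos.
have mp1 k i : measurable [set p : X * X | g p.1 k = i].
  rewrite -[X in measurable X]setTI.
  exact: (measurable_fst measurableT _ (mg k i)).
have mp2 k i : measurable [set p : X * X | g p.2 k = i].
  rewrite -[X in measurable X]setTI.
  exact: (measurable_snd measurableT _ (mg k i)).
(* The distance takes countably many values, so a preimage splits according to the index of first
   difference. *)
have mdist : measurable_fun [set: X * X] (fun p => code_dist g p.1 p.2 : R).
  move=> _ B mB; rewrite setTI.
  rewrite (_ : _ @^-1` _ = [set p : X * X |
    ((forall i, g p.1 i = g p.2 i) /\ B 0%R) \/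
    exists m, (g p.1 m <> g p.2 m /\ forall i, (i < m)%N -> g p.1 i = g p.2 i)
      /\ B ((1 / 2) ^+ m)%R]).
    apply: measurable_or_prop.
      apply: measurable_and_prop; last exact: measurable_const.
      apply: measurable_forall => i.
      exact: (@measurable_discrete2 _ _ _ _ _ _ (fun a b => a = b)).
    apply: measurable_exists => m.
    apply: measurable_and_prop; last exact: measurable_const.
    apply: measurable_and_prop.
      exact: (@measurable_discrete2 _ _ _ _ _ _ (fun a b => a <> b)).
    apply: measurable_forall => i; apply: measurable_impl.
    exact: (@measurable_discrete2 _ _ _ _ _ _ (fun a b => a = b)).
  apply/seteqP; split=> [[x y] /=|[x y] /=].
    by case: code_distP => [->|m gm gi] Bm; [left|right; exists m].
  case: code_distP => [gxy|m gm gi].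
    by rewrite gxy => -[[]//|[m [[]]]].
  move=> [[gxy _]|[n [[gn gni]]]]; first by rewrite gxy in gm.
  suff -> : n = m by [].
  by case: (ltngtP n m) => [/gi|/gni|].
split; first split.
- exact: code_dist_ge0.
- move=> x y; split; last first.
    by move=> ->; case: code_distP => // m.
  case: code_distP => [/ginj//|m _ _ /eqP].
  by rewrite expf_eq0 => /andP[_ /eqP h]; exfalso; lra.
- exact: code_dist_sym.
- exact: code_dist_triangle.
- by move=> x y; rewrite -(expr0 (1 / 2)%R); exact: code_dist_le.
- exact: mdist.
move=> x r [y0 /= y0r]; apply/gt0_negligible.
  exact: measurable_metric_ball.
have r0 : (0 < r)%R by apply: le_lt_trans y0r; exact: code_dist_ge0.
have [k kr] := half_expr_lt r0.
move=> neg; apply: (gpos x k); apply: negligibleS neg => y agr.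
by rewrite /=; apply: le_lt_trans kr; exact: code_dist_le.
Qed.

(** * Codes all of whose cylinders have positive measure *)

Section positive_code.
Context {R : realType} {disp : measure_display} {X : measurableType disp}.
Variable mu : {measure set X -> \bar R}.

Lemma nonatomic_split (A : set X) : nonatomic mu ->
  measurable A -> ~ mu.-negligible A ->
  exists B, [/\ measurable B, B `<=` A, ~ mu.-negligible B &
                ~ mu.-negligible (A `\` B)].
Proof.
move=> na mA A0; have /gt0_negligible/(na _ mA) := A0; move=> /(_ mA).
move=> [B [mB BA B0 BltA]]; exists B; split=> //.
  exact/gt0_negligible.
move=> /negligibleP AB0; move: BltA.
rewrite -{1}(setDUK BA) measureU0//; first by rewrite ltxx.
  exact: measurableD.
by apply: AB0; exact: measurableD.
Qed.

(** Repeated splitting gives decreasing non-null sets [F n]; cell [n] contains the points of [F n]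
    outside [F n.+1]. Points lying in every [F n] default to cell 0, which only enlarges it. *)
Lemma nonatomic_partition (A : set X) : nonatomic mu ->
  measurable A -> ~ mu.-negligible A ->
  exists2 D : X -> nat, forall n, measurable [set x | D x = n] &
    forall n, ~ mu.-negligible [set x | A x /\ D x = n].
Proof.
move=> na mA A0.
have /choice[f fP] (B : set X) : exists C, measurable B ->
    ~ mu.-negligible B -> [/\ measurable C, C `<=` B, ~ mu.-negligible C &
      ~ mu.-negligible (B `\` C)].
  have [mB|mB] := pselect (measurable B); last by exists set0 => /mB.
  have [B0|B0] := pselect (mu.-negligible B); first by exists set0.
  by have [C hC] := nonatomic_split na mB B0; exists C.
pose F n := iter n f A.
have FP n : measurable (F n) /\ ~ mu.-negligible (F n).
  by elim: n => [//|n [mF F0]]; have [] := fP _ mF F0.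
have FS n : F n.+1 `<=` F n by have [mF F0] := FP n; have [] := fP _ mF F0.
have Fsub n m : (n <= m)%N -> F m `<=` F n.
  move=> /subnK <-; elim: (m - n)%N => [//|i IH].
  by rewrite addSn; exact: subset_trans IH.
pose D x := odflt 0%N (first_index (fun n => ~ F n.+1 x)).
exists D => n.
  apply: (@measurable_discrete _ _ _ _ (fun o => odflt 0%N o = n)) => o.
  apply: measurable_first_index => i; apply: measurable_not.
  by have [] := FP i.+1.
have [mF F0] := FP n; have [_ _ _ h] := fP _ mF F0.
move=> neg; apply: h; apply: negligibleS neg => x [Fx nFx]; split.
  exact: (Fsub 0%N n (leq0n n) x Fx).
rewrite /D; suff -> : first_index (fun n => ~ F n.+1 x) = Some n by [].
by apply/first_index_eq_some; split=> // i ni; apply; exact: (Fsub i.+1 n).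
Qed.

(* N collects the points with a null cylinder; they are moved to a non-null cell
   {p = i0} and keep their code a.  That cell is split into non-null pieces
   indexed by the finite words w, and the points of piece w are coded by w, 2, a:
   the pieces approximate N, and the digit 2 marks the end of w. *)
Lemma positive_code_exists (a : X -> nat -> bool) (p : X -> nat) :
  nonatomic mu -> mu [set: X] != 0 ->
  injective a -> (forall k b, measurable [set x | a x k = b]) ->
  (forall i, measurable [set x | p x = i]) ->
  exists (g : X -> nat -> nat) (N : set X),
    [/\ mu.-negligible N, injective g,
        forall k i, measurable [set x | g x k = i],
        forall x k, ~ mu.-negligible [set y | code_agree g k x y] &
        forall x, ~ N x -> g x 0%N = p x].
Proof.
move=> na muT ainj ma mp.
have [i0 i0P] : exists i0, ~ mu.-negligible [set x | p x = i0].
  apply: contrapT => h; move/eqP: muT; apply; apply/negligibleP => //.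
  apply: (@negligibleS _ _ _ _ [set x | exists i, p x = i]).
    by move=> x _; exists (p x).
  by apply: negligible_exists => i; apply: contrapT => ?; apply: h; exists i.
have [D mD DP] := nonatomic_partition na (mp i0) i0P.
(* [inl n] labels piece [n] of the split cell [i0]; [inr] labels the other cells. *)
pose c x : nat + nat := if p x == i0 then inl (D x) else inr (p x).
have mc (k : nat + nat) : measurable [set x | c x = k].
  exact: (@measurable_discrete2 _ _ _ _ p D (fun i n =>
    (if i == i0 then inl n else inr i) = k)).
have cp x y : c x = c y -> p x = p y.
  by rewrite /c; case: eqP => [->|_]; case: eqP => [->//|_] => // -[].
pose C (k : nat + nat) (w : seq bool) : set X :=
  [set x | c x = k /\ forall i, (i < size w)%N -> a x i = nth false w i].
have mC k w : measurable (C k w).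
  apply: measurable_and_prop => //; apply: measurable_forall => i.
  exact: measurable_impl.
pose N : set X := [set x | exists k w, mu.-negligible (C k w) /\ C k w x].
have mN : measurable N.
  do 2 apply: measurable_exists => ?; apply: measurable_and_prop.
    exact: measurable_const.
  exact: mC.
have N0 : mu.-negligible N.
  do 2 apply: negligible_exists => ?.
  set S := C _ _; have [S0|S0] := pselect (mu.-negligible S).
    by apply: negligibleS S0 => x [].
  by apply: negligibleS (negligible_set0 _) => x [].
have mNb b : measurable [set x | `[< N x >] = b] by exact: measurable_asbool.
pose word n : seq bool := odflt [::] (unpickle n).
(* The digits inserted between the first digit and the code [a]. The flag [b] tells whether the
   point is in [N], where nothing is inserted. *)
pose pref (b : bool) (k : nat + nat) : seq nat :=
  if b then [::] else
  if k is inl n then rcons (map nat_of_bool (word n)) 2%N else [::].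
pose pre x := pref `[< N x >] (c x).
have mpre s : measurable [set x | pre x = s].
  exact: (@measurable_discrete2 _ _ _ _ _ _ (fun b k => pref b k = s)).
pose g x k : nat := if k is k'.+1 then
    if (k' < size (pre x))%N then nth 0%N (pre x) k'
    else nat_of_bool (a x (k' - size (pre x))%N)
  else if `[< N x >] then i0 else p x.
have preC x y : ~ N x -> ~ N y -> c x = c y -> pre x = pre y.
  by move=> /asboolPn/negbTE Nx /asboolPn/negbTE Ny cxy; rewrite /pre Nx Ny cxy.
have pre_last x : (0 < size (pre x))%N ->
    nth 0%N (pre x) (size (pre x)).-1 = 2%N.
  rewrite /pre /pref; case: ifP => // _; case: (c x) => // n _.
  by rewrite size_rcons nth_rcons size_map/= ltnn eqxx.
exists g, N; split=> //.
- move=> x y gxy.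
  (* If the prefix of [x'] were the longer one, its final digit 2 would face a digit of [a y'],
     which is 0 or 1. *)
  have size_le x' y' : g x' = g y' -> (size (pre x') <= size (pre y'))%N.
    move=> e; rewrite leqNgt; apply/negP => lt.
    have s0 : (0 < size (pre x'))%N by apply: leq_ltn_trans lt.
    have : g x' (size (pre x')).-1.+1 = g y' (size (pre x')).-1.+1 by rewrite e.
    rewrite /g /= prednK// leqnn pre_last// leqNgt lt /=.
    by case: (a _ _).
  have sxy : size (pre x) = size (pre y).
    by apply/eqP; rewrite eqn_leq !size_le.
  apply: ainj; apply/funext => i.
  have := congr1 (fun h => h (i + size (pre x)).+1%N) gxy.
  rewrite /g -sxy ltnNge leq_addl/= addnK.
  by case: (a x i); case: (a y i).
- move=> [|k] i.
    exact: (@measurable_discrete2 _ _ _ _ _ _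
      (fun (b : bool) j => (if b then i0 else j) = i)).
  rewrite (_ : [set x | _] = [set x | exists s, pre x = s /\
    (fun b : bool => (if (k < size s)%N then nth 0%N s k else b : nat) = i)
      (a x (k - size s)%N)]).
    apply: measurable_exists => s; apply: measurable_and_prop => //.
    exact: (@measurable_discrete _ _ _ _
      (fun b : bool => (if (k < size s)%N then nth 0%N s k else b : nat) = i)).
  by apply/seteqP; split=> [x /= <-|x /= [s [<- //]]]; exists (pre x).
(* For [x] outside [N]: if its code cylinder were null, so would be the set [C] given by its label
   and the first [k] digits of [a x], which would put [x] in [N]. *)
- move=> x k neg; have [Nx|Nx] := pselect (N x); last first.
    apply: (Nx); exists (c x), (mkseq (a x) k); split.
      apply: negligibleS (negligibleU neg N0) => y [cyx ay].
      have [Ny|Ny] := pselect (N y); [by right|left].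
      have [Nxb Nyb] : `[< N x >] = false /\ `[< N y >] = false.
        by split; apply/negbTE/asboolPn.
      case=> [_|i /ltnW ik] /=; first by rewrite Nxb Nyb; exact/esym/cp.
      rewrite (preC y x)//; case: ltnP => // _; congr nat_of_bool.
      rewrite ay ?size_mkseq ?nth_mkseq//.
        by rewrite (leq_ltn_trans (leq_subr _ _))// ltnW.
      by rewrite (leq_ltn_trans (leq_subr _ _))// ltnW.
    by split=> // i; rewrite size_mkseq => ik; rewrite nth_mkseq.
  (* For [x] in [N]: the piece whose word is the first [k] digits of [a x] lies, up to [N], in the
     code cylinder of [x]. *)
  apply: (DP (pickle (mkseq (a x) k))).
  apply: negligibleS (negligibleU neg N0) => y [py Dy].
  have [Ny|Ny] := pselect (N y); [by right|left].
  have Nxb : `[< N x >] by apply/asboolP.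
  have Nyb : `[< N y >] = false by apply/negbTE/asboolPn.
  case=> [_|i ik] /=; first by rewrite Nxb Nyb py.
  have -> : pre x = [::] by rewrite /pre Nxb.
  rewrite /= subn0.
  have -> : pre y = rcons (map nat_of_bool (mkseq (a x) k)) 2%N.
    by rewrite /pre Nyb /pref /c py eqxx Dy /word pickleK.
  have ik' : (i < k)%N by exact: ltnW.
  rewrite size_rcons nth_rcons size_map size_mkseq ltnS (ltnW ik') ik'.
  by rewrite (nth_map false) ?size_mkseq// nth_mkseq.
- by move=> x /asboolPn/negbTE Nx /=; rewrite Nx.
Qed.

End positive_code.

(** * From null itinerary classes to sensitivity *)

Lemma limn_esup_ge (R : realType) (u : (\bar R)^nat) (l : \bar R) :
  (forall M, exists2 n, (M <= n)%N & l <= u n) -> l <= limn_esup u.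
Proof.
move=> h; rewrite limn_esup_lim; apply: lime_ge; first exact: is_cvg_esups.
apply: nearW => M; have [n Mn lun] := h M.
by apply: (le_trans lun); apply: ereal_sup_ubound; exists n.
Qed.

Definition itinerary_class (X : Type) (T : X -> X) (p : X -> nat) (x : X) :=
  [set y | forall n, p (iter n T y) = p (iter n T x)].

Lemma code_dist_sensitive (R : realType) (disp : measure_display)
    (X : measurableType disp) (mu : {measure set X -> \bar R}) (T : X -> X)
    (p : X -> nat) (g : X -> nat -> nat) (N : set X) :
  nonsingular_system mu T -> mu.-negligible N ->
  (forall x, ~ N x -> g x 0%N = p x) ->
  (forall x, mu.-negligible (itinerary_class T p x)) ->
  W_measurably_sensitive mu T (code_dist g : X -> X -> R).
Proof.
move=> sys N0 gp p0.
have orbitN0 : mu.-negligible [set y | exists n, N (iter n T y)].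
  by apply: negligible_exists => n; exact: negligible_preimage_iter.
have class0 x : mu.-negligible (itinerary_class T (fun z => g z 0%N) x).
  (* The orbit of [x] may meet [N], where [g] and [p] can disagree. A member [y] of the class whose
     orbit avoids [N] then serves as reference point; if there is none, the class lies in a null
     set. *)
  have [[y [xy Ny]]|h] := pselect (exists y,
      itinerary_class T (fun z => g z 0%N) x y /\ ~ exists n, N (iter n T y)).
    apply: negligibleS (negligibleU (p0 y) orbitN0) => z xz.
    have [Nz|Nz] := pselect (exists n, N (iter n T z)); [by right|left] => n.
    rewrite -gp; last by move=> ?; apply: Nz; exists n.
    rewrite -gp; last by move=> ?; apply: Ny; exists n.
    by rewrite xz xy.
  apply: negligibleS orbitN0 => y xy; apply: contrapT => Ny; apply: h.
  by exists y.
(* Points with different first digits are at distance 1, so any constant below 1 would do. *)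
exists (1 / 2)%R; first lra.
(* If the upper limit is at most 1/2, the first digits agree from some time [M] on, so [iter M T y]
   lies in the null class of [iter M T x]; nonsingularity pulls this back to [y]. *)
move=> x; apply: (@negligibleS _ _ _ _ [set y | exists M,
    itinerary_class T (fun z => g z 0%N) (iter M T x) (iter M T y)]).
  move=> y /= ny; apply: contrapT => h; apply: ny.
  apply: (@lt_le_trans _ _ 1%:E); first by rewrite lte_fin; lra.
  apply: limn_esup_ge => M; apply: contrapT => hM; apply: h; exists M => n.
  apply: contrapT => gn; apply: hM; exists (n + M)%N; first exact: leq_addl.
  rewrite lee_fin !iterD -(expr0 (1 / 2)%R).
  by apply: code_dist_ge => /esym.
apply: negligible_exists => M.
exact: (negligible_preimage_iter M sys (class0 (iter M T x))).
Qed.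

Lemma sensitive_metric_exists (R : realType) (disp : measure_display)
    (X : measurableType disp) (mu : {measure set X -> \bar R}) (T : X -> X)
    (a : X -> nat -> bool) (p : X -> nat) :
  nonsingular_system mu T ->
  injective a -> (forall k b, measurable [set x | a x k = b]) ->
  (forall i, measurable [set x | p x = i]) ->
  (forall x, mu.-negligible (itinerary_class T p x)) ->
  exists2 d : X -> X -> R,
    compatible_metric mu d & W_measurably_sensitive mu T d.
Proof.
move=> sys ainj ma mp p0.
have [g [N [N0 ginj mg gpos gp]]] := positive_code_exists
  (system_nonatomic sys) (system_nonzero sys) ainj ma mp.
exists (code_dist g); first exact: compatible_code_dist.
exact: code_dist_sensitive gp p0.
Qed.

(** * Recurrence and the conservative ergodic case *)

Definition infinitely_often (X : Type) (T : X -> X) (U : set X) : set X :=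
  [set x | forall M, exists n, (M <= n)%N /\ U (iter n T x)].

Lemma infinitely_often_shift (X : Type) (T : X -> X) (U : set X) (x : X) :
  infinitely_often T U (T x) <-> infinitely_often T U x.
Proof.
split=> h M.
  by have [n [Mn Un]] := h M; exists n.+1; rewrite iterSr leqW.
have [[|n] [Mn Un]] := h M.+1; first by [].
by exists n; split=> //; rewrite -iterSr.
Qed.

Lemma measurable_infinitely_often (disp : measure_display)
    (X : measurableType disp) (T : X -> X) (U : set X) :
  measurable_fun [set: X] T -> measurable U ->
  measurable (infinitely_often T U).
Proof.
move=> mT mU; apply: measurable_forall => M; apply: measurable_exists => n.
apply: measurable_and_prop; first exact: measurable_const.
exact: measurable_preimage_iter.
Qed.

Section conservative_ergodic.
Context {R : realType} {disp : measure_display} {X : measurableType disp}.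
Variables (mu : {measure set X -> \bar R}) (T : X -> X).
Hypotheses (sys : nonsingular_system mu T) (cons : conservative mu T).

Lemma conservative_no_wandering (W : set X) : measurable W ->
  (forall n x, (0 < n)%N -> W x -> ~ W (iter n T x)) -> mu.-negligible W.
Proof.
move=> mW wand; apply: contrapT => /(gt0_negligible _ mW) /(cons mW).
move=> [n n0]; rewrite (_ : _ `&` _ = set0) ?measure0 ?ltxx//.
by apply/seteqP; split=> x // -[Wn Wx]; exact: (wand n x).
Qed.

(** A point of [B] with finitely many returns has a last visit, which lies in the set [W] of points
    of [B] that never return. [W] is wandering, hence null, and so are its preimages. *)
Lemma conservative_recurrence (B : set X) : measurable B ->
  mu.-negligible (B `\` infinitely_often T B).
Proof.
move=> mB.
pose W := [set x | B x /\ forall n, (0 < n)%N -> ~ B (iter n T x)].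
have mT := system_measurable sys.
have W0 : mu.-negligible W.
  apply: conservative_no_wandering => [|n x n0 [_ Wx] [/(Wx n n0)]//].
  apply: measurable_and_prop => //; apply: measurable_forall => n.
  apply: measurable_impl; apply: measurable_not.
  exact: measurable_preimage_iter.
apply: (@negligibleS _ _ _ _ [set x | exists m, W (iter m T x)]); last first.
  by apply: negligible_exists => m; exact: negligible_preimage_iter.
move=> x [Bx /existsNP[M hM]].
have noB n : (M <= n)%N -> ~ B (iter n T x).
  by move=> Mn Bn; apply: hM; exists n.
have exm : exists m, `[< B (iter m T x) >] by exists 0%N; apply/asboolP.
have ubm m : `[< B (iter m T x) >] -> (m <= M)%N.
  by move=> /asboolP Bm; rewrite leqNgt; apply/negP => /ltnW /noB.
have [m /asboolP Bm mmax] := ex_maxnP exm ubm.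
exists m; split=> // n n0; rewrite -iterD => /asboolP/mmax.
by rewrite -[leqRHS]add0n leq_add2r leqNgt n0.
Qed.

(** The set of points visiting [B] infinitely often is [T]-invariant, so it is null or conull; by
    recurrence it contains almost all of [B], so it is not null. *)
Lemma ergodic_infinitely_often (B : set X) : ergodic mu T ->
  measurable B -> ~ mu.-negligible B ->
  mu.-negligible (~` infinitely_often T B).
Proof.
move=> erg mB B0.
have mL : measurable (infinitely_often T B).
  by apply: measurable_infinitely_often => //; exact: system_measurable sys.
have [|L0|L0] := erg _ mL.
- by apply/seteqP; split=> x h; apply/infinitely_often_shift.
- exfalso; apply: B0.
  apply: negligibleS (negligibleU (conservative_recurrence mB)
    ((negligibleP mu mL).2 L0)) => x Bx.
  by have [?|?] := pselect (infinitely_often T B x); [right|left].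
- by apply/negligibleP => //; exact: measurableC.
Qed.

(* A class of positive measure returns to itself, so its itinerary is periodic
   and takes finitely many values; but almost every orbit visits every cell. *)
Lemma ergodic_itinerary_class (p : X -> nat) : ergodic mu T ->
  (forall i, measurable [set x | p x = i]) ->
  (forall i, ~ mu.-negligible [set x | p x = i]) ->
  forall x, mu.-negligible (itinerary_class T p x).
Proof.
move=> erg mp p0 x; apply: contrapT => C0.
have mC : measurable (itinerary_class T p x).
  apply: measurable_forall => n.
  apply: (measurable_preimage_iter n (system_measurable sys)
    (mp (p (iter n T x)))).
have [q q0 Cq] : exists2 q, (0 < q)%N &
    exists2 y, itinerary_class T p x y & itinerary_class T p x (iter q T y).
  have [q q0 pos] := cons mC ((gt0_negligible mu mC).2 C0).
  exists q => //; apply: contrapT => h; move: pos.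
  rewrite (_ : _ `&` _ = set0) ?measure0 ?ltxx//.
  by apply/seteqP; split=> y // -[yq y0]; apply: h; exists y.
have per n : p (iter (n + q) T x) = p (iter n T x).
  by case: Cq => y Cy Cqy; rewrite -Cy iterD Cqy.
(* A value exceeding all those of the first period is never taken. *)
have [j jP] : exists j, forall n, p (iter n T x) <> j.
  pose m := \max_(i < q) p (iter i T x).
  exists m.+1 => n; elim/ltn_ind: n => n IH.
  have [nq|qn] := ltnP n q.
    move=> pm; have := leq_bigmax (F := fun i : 'I_q => p (iter i T x))
      (Ordinal nq).
    by rewrite /= pm -/m ltnn.
  rewrite -(subnK qn) per; apply: IH; lia.
apply: C0; apply: negligibleS (ergodic_infinitely_often erg (mp j) (p0 j)).
move=> y Cy /(_ 0%N) [n [_ /=]].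
by rewrite Cy; exact: jP.
Qed.

End conservative_ergodic.

(** * Separating codes and countable covers by small balls *)

Lemma open_mdist_ball (R : realType) (Y : metricType R) (q : Y) (r : R) :
  open [set y | (mdist q y < r)%R].
Proof.
rewrite openE => y /= qy; apply/nbhs_ballP.
exists (r - mdist q y)%R; first by rewrite /= subr_gt0.
move=> z; rewrite ballEmdist /= => yz.
by apply: le_lt_trans (metric_triangle q y z) _; rewrite -ltrBrDl.
Qed.

(** The digits record membership in the balls of radius 1/(j+1) around the points of a countable
    dense set. A ball of radius below half the distance of two points that contains one of them
    misses the other. *)
Lemma standard_Borel_code (R : realType) (disp : measure_display)
    (X : measurableType disp) :
  standard_Borel R X ->
  exists2 a : X -> nat -> bool, injective a &
    forall k b, measurable [set x | a x k = b].
Proof.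
move=> [Y [f [[_ [D Dcount Ddense]] [_ finj fsurj] mf]]].
have /countable_injP[h hinj] := Dcount.
(* As [h] is injective on [D], this union is a single ball, or empty when no point of [D] has number
   [nj.1]. *)
pose V (nj : nat * nat) : set Y :=
  \bigcup_(q in [set q | D q /\ h q = nj.1])
    [set y | (mdist q y < nj.2.+1%:R^-1)%R].
have mV nj : measurable [set x | V nj (f x)].
  apply/mf; rewrite (_ : f @` _ = V nj).
    by apply: sub_sigma_algebra; apply: bigcup_open => q _;
      exact: open_mdist_ball.
  apply/seteqP; split=> [_ [x Vx <-//]|y Vy].
  by have [x _ xy] := fsurj y I; exists x => //=; rewrite xy.
pose a x k := if unpickle k is Some nj then `[< V nj (f x) >] else false.
exists a => [x y axy|k b]; last first.
  rewrite /a; case: unpickle => [nj|]; first exact: measurable_asbool.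
  exact: measurable_const.
apply: finj; rewrite ?inE//; apply: contrapT => fxy.
have d0 : (0 < mdist (f x) (f y) / 2)%R.
  by rewrite divr_gt0// mdist_gt0; apply/eqP.
have [j] := ltr_add_invr d0; rewrite add0r => jd.
have [] := Ddense _ _ (open_mdist_ball (f x) j.+1%:R^-1).
  by exists (f x); rewrite /= mdistxx invr_gt0.
move=> q [/= xq Dq].
have : V (h q, j) (f y).
  apply/asboolP; have := congr1 (fun u => u (pickle (h q, j))) axy.
  rewrite /a pickleK => <-; apply/asboolP; exists q => //=.
  by rewrite metric_sym.
move=> [q' [Dq' hq']] /= q'y.
have qq' : q' = q by apply: hinj => //; rewrite inE.
have := metric_triangle (f x) q (f y).
rewrite -qq' in xq * => tri.
have := lt_trans (le_lt_trans tri (ltrD xq q'y)) (ltrD jd jd).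
by rewrite -splitr ltxx.
Qed.

(** Balls of radius [r / 2] around [r]-separated points are disjoint and of positive measure. Among
    points whose ball fills a fixed amount of a set of finite measure, such families are bounded in
    size, and the balls of radius [r] around a maximal one cover these points. *)
Lemma compatible_metric_cover (R : realType) (disp : measure_display)
    (X : measurableType disp) (mu : {measure set X -> \bar R})
    (d : X -> X -> R) (r : R) :
  sigma_finite [set: X] mu -> mu [set: X] != 0 -> compatible_metric mu d ->
  (0 < r)%R -> exists c : nat -> X, forall x, exists i, (d (c i) x < r)%R.
Proof.
move=> [F FT FP] muT [dm dpos] r0.
have [x0 _] : [set: X] !=set0.
  by apply/set0P; apply: contra_neq muT => ->; rewrite measure0.
pose B x := [set y | (d x y < r / 2)%R].
have mB x : measurable (B x).
  by apply: measurable_metric_ball; exact: metric_measurable dm.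
have mBF x j : measurable (B x `&` F j).
  by apply: measurableI => //; have [] := FP j.
pose L (jn : nat * nat) := [set x | (jn.2.+1%:R^-1)%:E < mu (B x `&` F jn.1)].
have Lcover x : exists jn, L jn x.
  have Bx0 : 0 < mu (B x).
    apply: dpos; exists x; rewrite /=.
    by have /(metric_eq0 dm) -> := erefl x; rewrite divr_gt0.
  have [j /gt0_negligible j0] : exists j, ~ mu.-negligible (B x `&` F j).
    apply: contrapT => h; move/(gt0_negligible _ (mB x)): Bx0; apply.
    apply: (@negligibleS _ _ _ _ [set y | exists j, (B x `&` F j) y]).
      move=> y By; have : [set: X] y by [].
      by rewrite FT => -[j _ Fjy]; exists j.
    by apply: negligible_exists => j; apply: contrapT => ?; apply: h; exists j.
  have {}j0 := j0 (mBF x j).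
  suff [n hn] : exists n, (n.+1%:R^-1)%:E < mu (B x `&` F j) by exists (j, n).
  move: j0; case: (mu _) => [v|_|//]; last by exists 0%N; rewrite ltry.
  rewrite lte_fin => v0.
  have [n] := ltr_add_invr v0; rewrite add0r => nv.
  by exists n; rewrite lte_fin.
have Lfin jn : exists c : nat -> X,
    forall x, L jn x -> exists i, (d (c i) x < r)%R.
  case: jn => j n.
  pose sep k := exists c : nat -> X, (forall i, (i < k)%N -> L (j, n) (c i)) /\
    forall i i', (i < k)%N -> (i' < k)%N -> i <> i' -> (r <= d (c i) (c i'))%R.
  have [mF Ffin] := FP j.
  have [M hM] : exists M, forall k, sep k -> (k <= M)%N.
    have fF : mu (F j) \is a fin_num by rewrite ge0_fin_numE.
    (* The [k] disjoint pieces inside [F j] each have measure above 1/(n+1), so [k] is at most n+1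
       times the measure of [F j]. *)
    exists (Num.truncn (fine (mu (F j)) * n.+1%:R)) => k [c [cL csep]].
    rewrite truncn_ge_nat ?mulr_ge0 ?fine_ge0//.
    rewrite -ler_pdivrMr// -lee_fin fineK//.
    pose G i := if (i < k)%N then B (c i) `&` F j else set0.
    have mG i : measurable (G i) by rewrite /G; case: ifP.
    have tG : trivIset setT G.
      apply/trivIsetP => i i' _ _ /eqP ii'; rewrite /G.
      case: ltnP => ik; last by rewrite set0I.
      case: ltnP => ik'; last by rewrite setI0.
      apply/seteqP; split=> // y [[/= B1 _] [/= B2 _]].
      have := csep _ _ ik ik' ii'.
      have := metric_triangular dm (c i) y (c i').
      by rewrite (metric_symmetric dm y) /B /= in B1 B2 *; lra.
    apply: (@le_trans _ _ (mu (\big[setU/set0]_(i < k) G i))); last first.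
      rewrite le_measure ?inE//; first exact: bigsetU_measurable.
      rewrite -bigcup_mkord => y [i /= ik]; rewrite /G ik.
      by case.
    rewrite measure_bigsetU//.
    have -> : (k%:R / n.+1%:R)%:E = \sum_(i < k) (n.+1%:R^-1 : R)%:E.
      by rewrite sumEFin sumr_const card_ord mulr_natl.
    apply: lee_sum => i _; rewrite /G ltn_ord; apply/ltW.
    exact: (cL i (ltn_ord i)).
  have sep0 : exists k, `[< sep k >].
    by exists 0%N; apply/asboolP; exists (fun=> x0); split.
  have sepM k : `[< sep k >] -> (k <= M)%N by move=> /asboolP; exact: hM.
  have [k /asboolP [c [cL csep]] kmax] := ex_maxnP sep0 sepM.
  (* A point at distance at least [r] from all centres would enlarge the maximal family. *)
  exists c => x Lx; apply: contrapT => far.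
  have {}far i : (r <= d (c i) x)%R.
    by rewrite leNgt; apply/negP => cx; apply: far; exists i.
  have : sep k.+1.
    exists (fun i => if (i < k)%N then c i else x); split=> [i _|i i'].
      by case: ltnP => // /cL.
    rewrite !ltnS => ik i'k ii'; case: ltnP => ik1; case: ltnP => ik2.
    - exact: csep.
    - exact: far.
    - by rewrite metric_symmetric.
    - by exfalso; apply: ii'; lia.
  by move=> /asboolP /kmax; rewrite ltnn.
have [c cP] := choice Lfin.
exists (fun m => if unpickle m is Some (jn, i) then c jn i else x0) => x.
have [jn /cP [i ix]] := Lcover x.
by exists (pickle (jn, i)); rewrite pickleK.
Qed.

(** * Cluster points of orbits and length of agreement with them *)

Section markers.
Context {X : Type}.
Variables (T : X -> X) (a : X -> nat -> bool).

Definition cylinder (w : seq bool) : set X :=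
  [set x | forall i, (i < size w)%N -> a x i = nth false w i].

(** These are the first [k] digits of the lexicographically least cluster point of the codes along
    the orbit: [false] is appended whenever that extension is still visited infinitely often. *)
Fixpoint cluster_word (x : X) (k : nat) : seq bool :=
  if k is k'.+1 then
    let w := cluster_word x k' in
    rcons w (~~ `[< infinitely_often T (cylinder (rcons w false)) x >])
  else [::].

Lemma size_cluster_word x k : size (cluster_word x k) = k.
Proof. by elim: k => //= k IH; rewrite size_rcons IH. Qed.

Lemma cylinder_rcons w b x :
  cylinder (rcons w b) x <-> cylinder w x /\ a x (size w) = b.
Proof.
split=> [h|[h ab] i].
  split=> [i iw|].
    by rewrite h ?size_rcons ?nth_rcons ?iw// ltnW.
  by rewrite h ?size_rcons// nth_rcons ltnn eqxx.
rewrite size_rcons ltnS leq_eqVlt nth_rcons => /predU1P[->|iw].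
  by rewrite ltnn eqxx.
by rewrite iw; exact: h.
Qed.

(** If the extension by [false] is no longer visited after time [M'], all later visits to the word
    itself go to the extension by [true]. *)
Lemma cluster_word_infinitely_often x k :
  infinitely_often T (cylinder (cluster_word x k)) x.
Proof.
elim: k => [M|k IH /=]; first by exists M.
have [//|h] := asboolP (infinitely_often T _ x).
move=> M; move/existsNP: h => [M' hM'].
have [n [Mn Un]] := IH (maxn M M').
move: Mn; rewrite geq_max => /andP[Mn M'n].
exists n; split=> //; apply/cylinder_rcons; split=> //.
case E: (a _ _) => //; exfalso; apply: hM'; exists n; split=> //.
exact/cylinder_rcons.
Qed.

Lemma cluster_word_shift n x : cluster_word (iter n T x) = cluster_word x.
Proof.
elim: n => // n IH; rewrite iterS -IH; apply/funext; elim=> //= k ->.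
by congr (rcons _ (~~ _)); apply: asbool_equiv_eq;
  exact: infinitely_often_shift.
Qed.

Lemma cylinder_cluster_word_le x y j k : (j <= k)%N ->
  cylinder (cluster_word x k) y -> cylinder (cluster_word x j) y.
Proof.
move=> /subnK <-; elim: (k - j)%N => // i IH.
by rewrite addSn => /cylinder_rcons[/IH].
Qed.

(** The number of digits on which the code of [x] agrees with the cluster point of its own orbit.
    The shift to [k.+1] makes it the length of agreement, not the first failing length; [None] means
    that the code is the cluster point. *)
Definition marker_level (x : X) : option nat :=
  first_index (fun k => ~ cylinder (cluster_word x k.+1) x).

Lemma marker_level_none x y : injective a -> cluster_word x = cluster_word y ->
  marker_level x = None -> marker_level y = None -> x = y.
Proof.
rewrite /marker_level => ainj xy.
case: first_indexP => // hx _; case: first_indexP => // hy _.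
apply: ainj; apply/funext => k.
have /contrapT -> := hx k; last by rewrite size_cluster_word.
by have /contrapT -> := hy k; rewrite ?xy// size_cluster_word.
Qed.

(* The orbit follows its cluster point to any given depth infinitely often, and
   meets the cluster point itself at most once. *)
Lemma marker_level_unbounded x k : injective T -> injective a ->
  (forall n, (0 < n)%N -> iter n T x <> x) ->
  exists n m, (k <= m)%N /\ marker_level (iter n T x) = Some m.
Proof.
move=> Tinj ainj aper.
have visit M : exists n, (M <= n)%N /\
    (marker_level (iter n T x) = None \/
     exists m, (k <= m)%N /\ marker_level (iter n T x) = Some m).
  have [n [Mn Un]] := cluster_word_infinitely_often x k M; exists n; split=> //.
  rewrite /marker_level cluster_word_shift.
  case: first_indexP => [_|m hm _]; [by left|right; exists m; split=> //].
  rewrite leqNgt; apply/negP => mk; apply: hm.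
  exact: cylinder_cluster_word_le Un.
have [n1 [_ [none1|]]] := visit 0%N; last by exists n1.
have [n2 [n12 [none2|]]] := visit n1.+1; last by exists n2.
(* At both times the orbit is at the point coded by the cluster point; cancelling [n1] applications
   of the injective [T] makes [x] periodic. *)
exfalso; apply: (aper (n2 - n1)%N); first by rewrite subn_gt0.
have : iter n1 T (iter (n2 - n1) T x) = iter n1 T x.
  rewrite -iterD subnKC; last exact: ltnW.
  by apply: marker_level_none => //; rewrite !cluster_word_shift.
by move: (iter (n2 - n1) T x) => y; elim: n1 {none1 n12} => //= n IH /Tinj/IH.
Qed.

End markers.

(** * The aperiodic isometric case *)

Section isometry.
Context {R : realType} {disp : measure_display} {X : measurableType disp}.
Variables (mu : {measure set X -> \bar R}) (T : X -> X) (a : X -> nat -> bool).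
Hypotheses (sys : nonsingular_system mu T) (ainj : injective a)
  (ma : forall k b, measurable [set x | a x k = b]).

Lemma measurable_cylinder w : measurable (cylinder a w).
Proof. by apply: measurable_forall => i; exact: measurable_impl. Qed.

Lemma measurable_cluster_word k w :
  measurable [set x | cluster_word T a x k = w].
Proof.
elim: k w => [|k IH] w; first exact: (measurable_const ([::] = w)).
rewrite (_ : [set x | _] = [set x | exists v, cluster_word T a x k = v /\
    (fun b => rcons v (~~ b) = w)
      `[< infinitely_often T (cylinder a (rcons v false)) x >]]).
  apply: measurable_exists => v; apply: measurable_and_prop => //.
  apply: (@measurable_discrete _ _ _ _ (fun b => rcons v (~~ b) = w)) => b.
  apply: measurable_asbool; apply: measurable_infinitely_often.
    exact: system_measurable sys.
  exact: measurable_cylinder.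
apply/seteqP; split=> [x /= <-|x /= [v [-> //]]].
by exists (cluster_word T a x k).
Qed.

Lemma measurable_marker_level o : measurable [set x | marker_level T a x = o].
Proof.
apply: measurable_first_index => k; apply: measurable_not.
rewrite (_ : [set x | _] =
    [set x | exists w, cluster_word T a x k.+1 = w /\ cylinder a w x]).
  apply: measurable_exists => w; apply: measurable_and_prop.
    exact: measurable_cluster_word.
  exact: measurable_cylinder.
by apply/seteqP; split=> [x /= ?|x /= [w [-> //]]]; eexists; split.
Qed.

(** The code separates points, so singletons are measurable, and a singleton cannot be split into
    two non-null parts. *)
Lemma negligible_point (x : X) : mu.-negligible [set x].
Proof.
apply: contrapT => x0.
have mx : measurable [set x].
  rewrite (_ : [set x] = [set y | forall k, a y k = a x k]).
    by apply: measurable_forall.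
  apply/seteqP; split=> [y -> //|y /= axy]; apply: ainj; exact/funext.
have [B [_ BA B0 D0]] := nonatomic_split (system_nonatomic sys) mx x0.
have [Bx|Bx] := pselect (B x).
  by apply: D0; apply: negligibleS (negligible_set0 _) => y [-> /(_ Bx)].
by apply: B0; apply: negligibleS (negligible_set0 _) => y By;
  move: (By); rewrite (BA y By).
Qed.

Lemma isometry_partition (d : X -> X -> R) :
  aperiodic mu T -> compatible_metric mu d -> isometry_for d T ->
  exists2 p : X -> nat, forall i, measurable [set x | p x = i] &
    forall x, mu.-negligible (itinerary_class T p x).
Proof.
move=> aper cd iso; have [dm _] := cd.
have dxx x : d x x = 0%R by apply/(metric_eq0 dm).
have isoE n x y : d (iter n T x) (iter n T y) = d x y.
  by elim: n => //= n <-; rewrite iso.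
have Tinj : injective T.
  by move=> x y Txy; apply/(metric_eq0 dm); rewrite -iso Txy dxx.
have /choice[c cP] k : exists c : nat -> X,
    forall x, exists i, (d (c i) x < (1 / 2) ^+ k)%R.
  apply: compatible_metric_cover cd _; first exact: system_sigma_finite sys.
    exact: system_nonzero sys.
  by rewrite exprn_gt0.
pose idx k x := first_index (fun i => (d (c k i) x < (1 / 2) ^+ k)%R).
have midx k o : measurable [set x | idx k x = o].
  apply: measurable_first_index => i; apply: measurable_metric_ball.
  exact: metric_measurable dm.
have idxP k x y : idx k x = idx k y -> (d x y < (1 / 2) ^+ k + (1 / 2) ^+ k)%R.
  rewrite /idx; case: first_indexP => [h|i ix _].
    by have [i ix] := cP k x; case: (h i).
  case: first_indexP => // j jy _ [ij]; subst j.
  apply: le_lt_trans (metric_triangular dm x (c k i) y) _.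
  by rewrite (metric_symmetric dm x) ltrD.
(* The value 0 is reserved for points coded by their cluster point; otherwise [pickle] merges the
   level with a cell whose size is adapted to that level. *)
pose p x :=
  if marker_level T a x is Some k then (pickle (k, idx k x)).+1 else 0%N.
exists p => [i|x].
  rewrite (_ : [set x | _] = [set x | exists o, marker_level T a x = o /\
      (if o is Some k then (pickle (k, idx k x)).+1 else 0%N) = i]).
    apply: measurable_exists => o; apply: measurable_and_prop.
      exact: measurable_marker_level.
    case: o => [k|]; last exact: measurable_const.
    exact: (@measurable_discrete _ _ _ _ (fun o => (pickle (k, o)).+1 = i)).
  apply/seteqP; split=> y /=; first by move=> <-; exists (marker_level T a y).
  by case=> o [] <-.
pose Per := [set x | exists2 n : nat, (0 < n)%N & iter n T x = x].
(* A class of periodic points only is null by aperiodicity. Otherwise a nonperiodic member [y0] is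
   fixed, and every member turns out to equal [y0]. *)
have [[y0 [xy0 ny0]]|h] := pselect (exists y,
    itinerary_class T p x y /\ ~ Per y); last first.
  apply: negligibleS aper => y xy; apply: contrapT => ny; apply: h.
  by exists y.
apply: negligibleS (negligibleU aper (negligible_point y0)) => y xy; right.
apply/(metric_eq0 dm); apply/eqP; rewrite eq_le (metric_ge0 dm) andbT leNgt.
(* Here 2^-k is less than half of [d y y0]. At a time when the orbit of [y0] has level [m] at least
   [k], the orbit of [y] is in the same cell, so the isometry gives a distance below twice 2^-m, a
   contradiction. *)
apply/negP => d0; have [k kd] := half_expr_lt (divr_gt0 d0 (ltr0n _ 2)).
have [|n [m [km lev]]] := marker_level_unbounded (x := y0) k Tinj ainj.
  by move=> n n0 per; apply: ny0; exists n.
have : p (iter n T y) = p (iter n T y0) by rewrite xy xy0.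
rewrite {2}/p lev /p; case: (marker_level _ _ _) => // m'.
move=> [] /(pcan_inj pickleK) [em]; subst m'; move=> /idxP; rewrite isoE => dlt.
have mk : ((1 / 2) ^+ m <= (1 / 2) ^+ k :> R)%R by rewrite ler_wiXn2l//; lra.
move: dlt mk kd; set u := ((1 / 2) ^+ m)%R; set v := ((1 / 2) ^+ k)%R.
by move=> *; lra.
Qed.

End isometry.

Theorem corollary8p3 (R : realType) (disp : measure_display)
    (X : measurableType disp) (mu : {measure set X -> \bar R}) (T : X -> X)
    (hsys : nonsingular_system mu T)
    (hT : [/\ aperiodic mu T, forward_measurable T &
              exists2 d' : X -> X -> R,
                compatible_metric mu d' & isometry_for d' T]
          \/ (conservative mu T /\ ergodic mu T)) :
  exists2 d : X -> X -> R,
    compatible_metric mu d & W_measurably_sensitive mu T d.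
Proof.
have [a ainj ma] := standard_Borel_code (system_standard_Borel hsys).
suff [p mp p0] : exists2 p : X -> nat,
    forall i, measurable [set x | p x = i] &
    forall x, mu.-negligible (itinerary_class T p x).
  exact: sensitive_metric_exists hsys ainj ma mp p0.
case: hT => [[aper _ [d' cd' iso]]|[cons erg]].
  exact: isometry_partition hsys ainj ma _ aper cd' iso.
have X0 : ~ mu.-negligible [set: X].
  by move=> /negligibleP h; move/eqP: (system_nonzero hsys); apply; exact: h.
have [p mp p0] := nonatomic_partition (system_nonatomic hsys) measurableT X0.
exists p => //; apply: ergodic_itinerary_class => // i neg.
by apply: (p0 i); apply: negligibleS neg => x [].
Qed.
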